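(* Let $\lambda_4\approx 0.434965$ be the smallest positive root of $8x^{10} - 724x^9 - 7040x^8 - 7612x^7 + 11321x^6 + 23576x^5 + 11895x^4 - 593x^3 - 2265x^2 - 679x = 65$, let $\lambda_5\approx 1.23423$ be the positive root of $-24x^{11} - 952x^{10} - 11612x^9 - 25296x^8 - 9658x^7 + 25646x^6 + 36870x^5 + 22158x^4 + 7266x^3 + 1356x^2 + 137x + 6=0$, and let $\lambda_6\approx 2.27938$ be the positive root of $132x^7 + 252x^6 - 318x^5 - 1340x^4 - 1477x^3 - 747x^2 - 181x = 17$. Then: (i) for every $\lambda\in(\lambda_4,\lambda_5)$, $\alpha_{G_{22}}(\lambda) < \min\{\alpha_{G_{\mathrm{ROB}}}(\lambda),\ \alpha_{\mathrm{CYC}_{13}}(\lambda)\}$; (ii) for every $\lambda\in(\lambda_5,\lambda_6)$, $\alpha_{G_{20}}(\lambda) < \min\{\alpha_{G_{\mathrm{ROB}}}(\lambda),\ \alpha_{\mathrm{CYC}_{13}}(\lambda)\}$.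
   Context: Graphs are finite and simple. For a graph $G$, $i_k(G)$ denotes the number of independent sets of $G$ with exactly $k$ vertices (so $i_0(G)=1$). The partition function of $G$ is $P_G(\lambda)=\sum_{k\ge 0} i_k(G)\lambda^k$, and the occupancy fraction of $G$ at fugacity $\lambda$ is $\alpha_G(\lambda)=\frac{\lambda P_G'(\lambda)}{|V(G)|\,P_G(\lambda)}$. $\mathrm{CYC}_{13}$ is the cyclotomic-13 graph: vertex set $\mathbb{Z}/13\mathbb{Z}$, with $u$ and $v$ adjacent if and only if $u-v\in\{\pm1,\pm5\}$. $G_{\mathrm{ROB}}$ is the Robertson graph, i.e. the $(4,5)$-cage: the unique $4$-regular graph of girth $5$ on $19$ vertices. $G_{20}$ is the $4$-regular triangle-free graph on vertex set $\{0,1,\ldots,19\}$ whose edges are those of the $20$-cycle $0,1,\ldots,19,0$ together with the chords $\{0,5\},\{5,10\},\{10,15\},\{15,0\}$, $\{3,19\},\{1,17\},\{7,11\},\{9,13\}$, $\{3,13\},\{7,17\}$, $\{11,19\},\{1,9\}$, $\{4,8\},\{2,6\},\{12,16\},\{14,18\}$, $\{8,18\},\{2,12\}$, $\{4,16\},\{6,14\}$. (Its graph6 encoding, up to isomorphism, is \texttt{S@?IC?g@S\_P?@aOWOS@ACSD@GGPCg?gB?}.) $G_{22}$ is the $4$-regular triangle-free graph on vertex set $\mathbb{Z}/22\mathbb{Z}$ in which every $i$ is adjacent to $i\pm1$, every even $i$ is in addition adjacent to $i\pm4$, and every odd $i$ is in addition adjacent to $i\pm8$. (Its graph6 encoding,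 up to isomorphism, is \texttt{UIAC@OOA\_H@@?Qo?c\_?cH@O?OQD?GIC?OG\_`?KQ?}.) *)

(* Defs.v *)
From HB Require Import structures.
From mathcomp Require Import all_boot all_order all_algebra.
From mathcomp Require Import reals.

Set Implicit Arguments.
Unset Strict Implicit.
Unset Printing Implicit Defensive.

Import Order.TTheory GRing.Theory Num.Theory.
Local Open Scope ring_scope.

Record sgraph := SGraph {
  vertex :> finType;
  adj : rel vertex;
  adj_sym : symmetric adj;
  adj_irr : irreflexive adj
}.
Arguments adj {s} _ _.

Section Graphs.
Variable G : sgraph.

Definition independent (S : {set G}) : bool :=
  [forall u in S, forall v in S, ~~ adj u v].

Definition indep_num (k : nat) : nat :=
  #|[set S : {set G} | independent S && (#|S| == k)]|.

Definition regular (d : nat) : Prop :=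
  forall v : G, #|[set u | adj v u]| = d.

(* [ucycle] also accepts closed walks u, v, u of length 2; every use below
   therefore restricts to lengths at least 3. *)
Definition has_cycle (k : nat) : Prop :=
  exists2 c : seq G, size c = k & ucycle adj c.

Definition has_girth (g : nat) : Prop :=
  [/\ (3 <= g)%N, has_cycle g
    & forall k, (3 <= k < g)%N -> ~ has_cycle k].

Definition partition_function (R : realType) : {poly R} :=
  \poly_(k < #|G|.+1) (indep_num k)%:R.

Definition occupancy (R : realType) (x : R) : R :=
  let P := partition_function R in x * (P^`()).[x] / (#|G|%:R * P.[x]).

End Graphs.

Section EdgeList.
Variables (n : nat) (E : seq (nat * nat)).

Definition edge_rel : rel 'I_n :=
  fun u v => ((val u, val v) \in E) || ((val v, val u) \in E).

Lemma edge_rel_sym : symmetric edge_rel.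
Proof. by move=> u v; rewrite /edge_rel orbC. Qed.

Lemma edge_rel_irr : all (fun e => e.1 != e.2) E -> irreflexive edge_rel.
Proof.
move=> /allP loopfree u; rewrite /edge_rel orbb.
by apply/negP => /loopfree /=; rewrite eqxx.
Qed.

Definition edge_graph (loopfree : all (fun e => e.1 != e.2) E) : sgraph :=
  SGraph edge_rel_sym (edge_rel_irr loopfree).

End EdgeList.

Definition adj13 : rel 'Z_13 :=
  fun u v => u - v \in [:: 1; - 1; 5%:R; - 5%:R].

Lemma adj13_sym : symmetric adj13.
Proof.
move=> u v; rewrite /adj13 -(opprB v u) !inE !eqr_opp.
rewrite ![- (v - u) == _]eqr_oppLR.
by do ![case: (_ == _)].
Qed.

Lemma adj13_irr : irreflexive adj13.
Proof. by move=> u; rewrite /adj13 subrr. Qed.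

Definition CYC13 : sgraph := SGraph adj13_sym adj13_irr.

(* The Robertson graph is the unique graph, up to isomorphism, satisfying this
   predicate; [exists_Robertson] below gives a model. *)
Definition is_Robertson (G : sgraph) : Prop :=
  [/\ #|G| = 19%N, regular G 4 & has_girth G 5].

Definition edges20 : seq (nat * nat) :=
  [seq (i, (i.+1 %% 20)%N) | i <- iota 0 20] ++
  [:: (0, 5); (5, 10); (10, 15); (15, 0);
      (3, 19); (1, 17); (7, 11); (9, 13);
      (3, 13); (7, 17);
      (11, 19); (1, 9);
      (4, 8); (2, 6); (12, 16); (14, 18);
      (8, 18); (2, 12);
      (4, 16); (6, 14)]%N.

Lemma edges20_loopfree : all (fun e => e.1 != e.2) edges20.
Proof. by []. Qed.

Definition G20 : sgraph := edge_graph 20 edges20_loopfree.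

Definition adj22 : rel 'Z_22 :=
  fun i j => [|| j - i \in [:: 1; - 1],
                 ~~ odd i && (j - i \in [:: 4%:R; - 4%:R])
               | odd i && (j - i \in [:: 8%:R; - 8%:R])].

Lemma adj22_sym : symmetric adj22.
Proof.
have H : all (fun i => all (fun j => adj22 (inZp i) (inZp j)
                                     == adj22 (inZp j) (inZp i))
                           (iota 0 22)) (iota 0 22) by vm_compute.
move=> i j; rewrite -(valZpK i) -(valZpK j); apply/eqP.
have mem (k : 'Z_22) : val k \in iota 0 22 by rewrite mem_iota; apply: ltn_ord.
exact: (allP (allP H _ (mem i)) _ (mem j)).
Qed.

Lemma adj22_irr : irreflexive adj22.
Proof. by move=> i; rewrite /adj22 subrr /= !andbF. Qed.

Definition G22 : sgraph := SGraph adj22_sym adj22_irr.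

(* In [ring_scope] a literal [n] is expanded to the unary numeral [n], which
   overflows the stack for large [n]; [n%N%:R] denotes the same ring element,
   but numerals of [nat_scope] above 5000 are kept unexpanded. *)
Definition lambda4_eq (R : realType) (x : R) : Prop :=
  8 * x ^+ 10 - 724 * x ^+ 9 - 7040%N%:R * x ^+ 8 - 7612%N%:R * x ^+ 7
  + 11321%N%:R * x ^+ 6 + 23576%N%:R * x ^+ 5 + 11895%N%:R * x ^+ 4 - 593 * x ^+ 3
  - 2265 * x ^+ 2 - 679 * x = 65.

Definition lambda5_eq (R : realType) (x : R) : Prop :=
  - 24 * x ^+ 11 - 952 * x ^+ 10 - 11612%N%:R * x ^+ 9 - 25296%N%:R * x ^+ 8
  - 9658%N%:R * x ^+ 7 + 25646%N%:R * x ^+ 6 + 36870%N%:R * x ^+ 5 + 22158%N%:R * x ^+ 4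
  + 7266%N%:R * x ^+ 3 + 1356 * x ^+ 2 + 137 * x + 6 = 0.

Definition lambda6_eq (R : realType) (x : R) : Prop :=
  132 * x ^+ 7 + 252 * x ^+ 6 - 318 * x ^+ 5 - 1340 * x ^+ 4
  - 1477 * x ^+ 3 - 747 * x ^+ 2 - 181 * x = 17.

Definition positive_root (R : realType) (eqn : R -> Prop) (x : R) : Prop :=
  0 < x /\ eqn x.

Definition smallest_positive_root (R : realType) (eqn : R -> Prop) (x : R) :
    Prop :=
  positive_root eqn x /\ forall y, positive_root eqn y -> x <= y.

(* The decimal approximations, up to one unit in the last digit. *)
Definition decimal_values (R : realType) (l4 l5 l6 : R) : Prop :=
  [/\ `|l4 - 434965%N%:R / 10 ^+ 6| < 1 / 10 ^+ 6,
      `|l5 - 123423%N%:R / 10 ^+ 5| < 1 / 10 ^+ 5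
    & `|l6 - 227938%N%:R / 10 ^+ 5| < 1 / 10 ^+ 5].

Definition edgesRob : seq (nat * nat) :=
  [seq (i, (i.+1 %% 19)%N) | i <- iota 0 19] ++
  [:: (0, 4); (0, 7); (1, 9); (1, 12); (2, 6); (2, 14); (3, 8); (3, 11);
      (4, 15); (5, 13); (5, 17); (6, 10); (7, 16); (8, 13); (9, 17);
      (10, 15); (11, 18); (12, 16); (14, 18)]%N.

Lemma edgesRob_loopfree : all (fun e => e.1 != e.2) edgesRob.
Proof. by []. Qed.

Definition adjRob : rel nat :=
  fun i j => ((i, j) \in edgesRob) || ((j, i) \in edgesRob).

Lemma mem_iota19 (k : 'I_19) : val k \in iota 0 19.
Proof. by rewrite mem_iota; apply: ltn_ord. Qed.

Lemma adjRob_regular (v : 'I_19) : count (adjRob v) (iota 0 19) = 4%N.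
Proof.
have H : all (fun i => count (adjRob i) (iota 0 19) == 4) (iota 0 19).
  by vm_compute.
by apply/eqP; apply: (allP H); apply: mem_iota19.
Qed.

Lemma adjRob_no3 (a b c : 'I_19) :
  adjRob a b -> adjRob b c -> adjRob c a -> False.
Proof.
have H : all (fun a => all (fun b => if adjRob a b then
           all (fun c => if adjRob b c then ~~ adjRob c a else true)
           (iota 0 19) else true) (iota 0 19)) (iota 0 19) by vm_compute.
move=> ab bc ca; move/allP: H => /(_ _ (mem_iota19 a)).
move/allP => /(_ _ (mem_iota19 b)); rewrite ab.
by move/allP => /(_ _ (mem_iota19 c)); rewrite bc ca.
Qed.

Lemma adjRob_no4 (a b c d : 'I_19) : a != c -> b != d ->
  adjRob a b -> adjRob b c -> adjRob c d -> adjRob d a -> False.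
Proof.
have H : all (fun a => all (fun b => if adjRob a b then
           all (fun c => if adjRob b c then (if a == c then true else
           all (fun d => if adjRob c d then
             (if b == d then true else ~~ adjRob d a) else true)
           (iota 0 19)) else true) (iota 0 19) else true)
           (iota 0 19)) (iota 0 19) by vm_compute.
move=> ac bd ab bc cd da; move/allP: H => /(_ _ (mem_iota19 a)).
move/allP => /(_ _ (mem_iota19 b)); rewrite ab.
move/allP => /(_ _ (mem_iota19 c)); rewrite bc.
rewrite -[val a == val c]/(a == c) (negbTE ac).
move/allP => /(_ _ (mem_iota19 d)); rewrite cd.
by rewrite -[val b == val d]/(b == d) (negbTE bd) da.
Qed.

Lemma exists_Robertson : exists G, is_Robertson G.
Proof.
exists (edge_graph 19 edgesRob_loopfree); split.
- exact: card_ord.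
- move=> v; apply: etrans (adjRob_regular v).
  rewrite cardsE -sum1_card -val_enum_ord count_map -sum1_count big_enum_cond.
  exact: eq_bigl.
- split=> //.
    exists [:: (inord 0 : 'I_19); inord 1; inord 2; inord 3; inord 4] => //.
    apply/andP; split.
      by rewrite /= /edge_rel /= !inordK.
    by rewrite -(map_inj_uniq val_inj) /= !inordK.
  move=> k /andP[k3 k5] [c sc /andP[cyc un]].
  case: c sc cyc un => [|a [|b [|c [|d [|e s]]]]] sc; subst k => //.
  + by case/and4P=> ab bc ca _ _; apply: adjRob_no3 ab bc ca.
  + case/and5P=> ab bc cd da _.
    rewrite /= !inE !negb_or => /and4P[/and3P[_ ac _] /andP[_ bd] _ _].
    exact: adjRob_no4 ac bd ab bc cd da.
Qed.

(* Main.v *)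
Require Import Defs.
From HB Require Import structures.
From Stdlib Require Import ZArith.
From mathcomp Require Import all_boot all_order all_algebra.
From mathcomp Require Import zify ssrZ ring lra.
From mathcomp Require Import reals.

(** The occupancy fractions are explicit rational functions once the
    independence polynomials are known, and comparing two of them amounts to the
    sign of a cross polynomial n_H P_G' P_H - n_G P_H' P_G.  For (G22, Robertson)
    it is 11 x^4 times the polynomial defining lambda4, for (G20, CYC13) it is
    -52 x^3 times the one defining lambda6; the two other cross polynomials are
    positive on intervals containing the range of x.  Signs are read off integer
    coefficients: after a Moebius substitution mapping (0, +oo) onto the interval,
    either no coefficient is negative, or the coefficients change sign only once,
    so that there is a single crossing.

    The independence polynomial of an arbitrary 4-regular graph of girth 5 on 19
    vertices is found by exhaustive search.  A vertex r, its 4 neighbours and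
    their 12 further neighbours leave two vertices w and z; the unknown adjacency
    rows are filled in one by one, any two vertices having at most one common
    neighbour, and none if they are adjacent.  Sorting the children of each
    neighbour of r by adjacency to w and z breaks enough of the symmetry to leave
    about a hundred matrices, all with the same independence polynomial. *)

Set Implicit Arguments.
Unset Strict Implicit.
Unset Printing Implicit Defensive.

Import Order.TTheory GRing.Theory Num.Theory.
Local Open Scope ring_scope.
(* The key [Z] is taken by [int_scope]. *)
Delimit Scope Z_scope with BZ.

(** * Polynomials with integer coefficients *)

Fixpoint zadd (a b : seq Z) : seq Z :=
  match a, b with
  | x :: a', y :: b' => Z.add x y :: zadd a' b'
  | [::], _ => b
  | _, [::] => a
  end.

Definition zscale (c : Z) (a : seq Z) : seq Z := map (Z.mul c) a.

Fixpoint zmul (a b : seq Z) : seq Z :=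
  if a is x :: a' then zadd (zscale x b) (0%BZ :: zmul a' b) else [::].

Fixpoint zderiv (a : seq Z) : seq Z :=
  if a is _ :: a' then zadd a' (0%BZ :: zderiv a') else [::].

Fixpoint zpow (a : seq Z) (n : nat) : seq Z :=
  if n is m.+1 then zmul a (zpow a m) else [:: 1%BZ].

(* The numerator Y^(size a - 1) * a(X / Y) of a rational substitution. *)
Fixpoint zhom (X Y a : seq Z) : seq Z :=
  if a is c :: a' then
    zadd (zscale c (zpow Y (size a'))) (zmul X (zhom X Y a'))
  else [::].

(** Positive at [x > 0] when the graph with [m] vertices and polynomial [a] has the smaller
    occupancy fraction. *)
Definition zcross (m n : Z) (a b : seq Z) : seq Z :=
  zadd (zscale m (zmul (zderiv b) a)) (zscale (- n)%BZ (zmul (zderiv a) b)).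

Definition znonneg : seq Z -> bool := all (Z.leb 0).

Definition zpositive (a : seq Z) : bool := znonneg a && has (Z.ltb 0) a.

(** At most one sign change, from nonpositive to nonnegative coefficients: past any positive point
    where it is nonnegative, such a polynomial is nondecreasing. *)
Fixpoint znondec (a : seq Z) : bool :=
  if a is c :: a' then if Z.leb c 0 then znondec a' else znonneg a else true.

Definition zincr (a : seq Z) : bool :=
  if a is c :: a' then Z.ltb c 0 && znondec a' else false.

(** * Evaluation at real points and sign criteria *)

Section Evaluation.
Variable R : realType.
Implicit Types (a b X Y : seq Z) (x y s t : R).

Definition ZR (z : Z) : R := (int_of_Z z)%:~R.

Lemma ZRD u v : ZR (u + v)%BZ = ZR u + ZR v.
Proof. by rewrite /ZR -intrD; congr (_%:~R); exact: (rmorphD int_of_Z u v). Qed.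

Lemma ZRM u v : ZR (u * v)%BZ = ZR u * ZR v.
Proof. by rewrite /ZR -intrM; congr (_%:~R); exact: (rmorphM int_of_Z u v). Qed.

Lemma ZRN u : ZR (- u)%BZ = - ZR u.
Proof. by rewrite /ZR -intrN; congr (_%:~R); exact: (rmorphN int_of_Z u). Qed.

Lemma ZR_nat n : n%:R = ZR (Z.of_nat n).
Proof. by rewrite /ZR -[LHS]/((Posz n)%:~R); congr (_%:~R); lia. Qed.

Lemma ZR_ge0 z : Z.leb 0 z -> 0 <= ZR z.
Proof. by move=> h; rewrite /ZR ler0z; lia. Qed.

Lemma ZR_le0 z : Z.leb z 0 -> ZR z <= 0.
Proof. by move=> h; rewrite /ZR lerz0; lia. Qed.

Lemma ZR_gt0 z : Z.ltb 0 z -> 0 < ZR z.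
Proof. by move=> h; rewrite /ZR ltr0z; lia. Qed.

Lemma ZR_lt0 z : Z.ltb z 0 -> ZR z < 0.
Proof. by move=> h; rewrite /ZR ltrz0; lia. Qed.

Fixpoint zpoly a : {poly R} :=
  if a is c :: a' then zpoly a' * 'X + (ZR c)%:P else 0.

Definition ev a x : R := (zpoly a).[x].

Lemma ev_nil x : ev [::] x = 0.
Proof. by rewrite /ev horner0. Qed.

Lemma ev_cons c a x : ev (c :: a) x = ZR c + x * ev a x.
Proof. by rewrite /ev /= hornerD hornerMX hornerC mulrC addrC. Qed.

Lemma coef_zpoly a k : (zpoly a)`_k = ZR (nth 0%BZ a k).
Proof.
elim: a k => [|c a IH] [|k] /=; rewrite ?coef0 ?coefD ?coefMX ?coefC //=.
  by rewrite add0r.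
by rewrite addr0.
Qed.

Lemma ev_add a b x : ev (zadd a b) x = ev a x + ev b x.
Proof.
elim: a b => [|c a IH] [|d b] /=; rewrite ?ev_nil ?add0r ?addr0 //.
by rewrite !ev_cons IH ZRD; ring.
Qed.

Lemma ev_scale c a x : ev (zscale c a) x = ZR c * ev a x.
Proof.
elim: a => [|d a IH] /=; first by rewrite !ev_nil mulr0.
by rewrite !ev_cons [ev (map _ _) x]IH ZRM; ring.
Qed.

Lemma ev_mul a b x : ev (zmul a b) x = ev a x * ev b x.
Proof.
elim: a => [|c a IH] /=; first by rewrite !ev_nil mul0r.
by rewrite ev_add ev_scale !ev_cons IH /ZR /=; ring.
Qed.

Lemma ev_pow a n x : ev (zpow a n) x = ev a x ^+ n.
Proof.
elim: n => [|n IH] /=; first by rewrite ev_cons ev_nil /ZR; ring.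
by rewrite ev_mul IH exprS.
Qed.

Lemma ev_deriv a x : (zpoly a)^`().[x] = ev (zderiv a) x.
Proof.
elim: a => [|c a IH] /=; first by rewrite derivC horner0 ev_nil.
rewrite derivD derivC addr0 derivM derivX mulr1 hornerD hornerMX IH ev_add ev_cons.
rewrite /ZR /ev /=.
by ring.
Qed.

(** The extra factor [ev Y t] raises the exponent from [size a - 1] to [size a], so the empty list
    needs no special case. *)
Lemma ev_hom X Y a t : ev Y t != 0 ->
  ev (zhom X Y a) t * ev Y t = ev Y t ^+ size a * ev a (ev X t / ev Y t).
Proof.
move=> Y0; elim: a => [|c a IH] /=; first by rewrite !ev_nil mulr0 mul0r.
rewrite ev_add ev_scale ev_pow ev_mul ev_cons mulrDl -[ev X t * _ * _]mulrA IH.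
by rewrite exprS; field.
Qed.

Lemma ev_ge0 a t : znonneg a -> 0 <= t -> 0 <= ev a t.
Proof.
move=> + t0; elim: a => [|c a IH] /=; first by rewrite ev_nil.
case/andP=> c0 /IH a0; rewrite ev_cons.
by rewrite addr_ge0 ?ZR_ge0 ?mulr_ge0.
Qed.

Lemma ev_gt0 a t : zpositive a -> 0 < t -> 0 < ev a t.
Proof.
case/andP=> + + t0; elim: a => [|c a IH] //= /andP[c0 a0].
rewrite ev_cons; case/orP=> [c1|/(IH a0) a1].
  by rewrite ltr_wpDr ?ZR_gt0 ?mulr_ge0 ?ev_ge0 // ltW.
by rewrite ltr_wpDl ?ZR_ge0 ?mulr_gt0.
Qed.

Lemma ev_ge0_homo a s t : znonneg a -> 0 <= s -> s <= t -> ev a s <= ev a t.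
Proof.
move=> + s0 st; elim: a => [|c a IH] /=; first by rewrite !ev_nil.
case/andP=> c0 a0; rewrite !ev_cons lerD2l ler_pM ?IH //.
exact: ev_ge0.
Qed.

Lemma znondec_homo a s t : znondec a -> 0 < s -> s <= t ->
  0 <= ev a s -> ev a s <= ev a t.
Proof.
move=> + s0 st; elim: a => [|c a IH] /=; first by rewrite !ev_nil.
case: ifP => [c0 a0|_ ca _]; last exact: (@ev_ge0_homo (c :: a)) ca (ltW s0) st.
rewrite !ev_cons => h; have := ZR_le0 c0 => c1.
(* As [c] is nonpositive, a nonnegative total forces the remaining Horner value to be
   nonnegative. *)
have e0 : 0 <= ev a s by rewrite -(pmulr_rge0 _ s0); lra.
by rewrite lerD2l ler_pM ?IH // ltW.
Qed.

(* The constant term is negative and, as long as the value is nonnegative,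
   Horner's nested partial values are nonnegative, hence nondecreasing. *)
Lemma zincr_homo a s t : zincr a -> 0 < s -> s < t ->
  0 <= ev a s -> ev a s < ev a t.
Proof.
case: a => [|c a] //= /andP[c0 a0] s0 st; rewrite !ev_cons => h.
have := ZR_lt0 c0 => c1.
have e0 : 0 < ev a s by rewrite -(pmulr_rgt0 _ s0); lra.
have e1 := znondec_homo a0 s0 (ltW st) (ltW e0).
rewrite ltrD2l; apply: (@lt_le_trans _ _ (t * ev a s)); first by rewrite ltr_pM2r.
by rewrite ler_pM2l // (lt_trans s0).
Qed.

(** Increasing bijection from (p/d, q/d) onto (0, +oo), inverse to t -> (p + q t) / (d + d t), the
    substitution made by [zhom [:: p; q] [:: d; d]]. *)
Definition moebius (p q d : Z) x : R := (ZR d * x - ZR p) / (ZR q - ZR d * x).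

Lemma moebius_gt0 p q d x : ZR p < ZR d * x < ZR q -> 0 < moebius p q d x.
Proof. by case/andP=> px xq; rewrite divr_gt0 ?subr_gt0. Qed.

Lemma moebius_incr p q d x y : (0 < d)%BZ -> ZR p < ZR d * x ->
  x < y -> ZR d * y < ZR q -> moebius p q d x < moebius p q d y.
Proof.
move=> d0 px xy yq; have dp : 0 < ZR d by apply: ZR_gt0; lia.
have xy' : ZR d * x < ZR d * y by rewrite ltr_pM2l.
rewrite /moebius ltr_pM ?subr_ge0 ?invr_ge0 ?subr_ge0 ?(ltW px) ?ltrD2r //.
  by rewrite ltW // (lt_trans xy').
by rewrite ltf_pV2 ?posrE ?subr_gt0 ?(lt_trans xy') // ltrD2l ltrN2.
Qed.

(** The denominator [d * (1 + t)] is positive, so clearing its powers preserves signs. *)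
Lemma ev_moebius (p q d : Z) a x : (0 < d)%BZ -> ZR p < ZR d * x < ZR q ->
  exists2 c : R, 0 < c &
    ev (zhom [:: p; q] [:: d; d] a) (moebius p q d x) = c * ev a x.
Proof.
move=> d0 pxq; have t0 := moebius_gt0 pxq; case/andP: pxq => px xq.
have dp : 0 < ZR d by apply: ZR_gt0; lia.
have qx : ZR q - ZR d * x != 0 by rewrite subr_eq0 gt_eqF.
have qp : ZR q - ZR p != 0 by rewrite subr_eq0 gt_eqF // (lt_trans px).
set t := moebius p q d x in t0 *.
have Y : ev [:: d; d] t = ZR d * (1 + t) by rewrite !ev_cons ev_nil; ring.
have t1 : 0 < 1 + t by rewrite addr_gt0.
have Y0 : 0 < ev [:: d; d] t by rewrite Y mulr_gt0.
exists (ev [:: d; d] t ^+ size a / ev [:: d; d] t).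
  by rewrite divr_gt0 ?exprn_gt0.
apply: (mulIf (lt0r_neq0 Y0)); rewrite ev_hom ?lt0r_neq0 //.
rewrite mulrAC divfK ?lt0r_neq0 //; congr (_ * ev a _).
have t1E : 1 + t = (ZR q - ZR p) / (ZR q - ZR d * x).
  by rewrite /t /moebius; field.
rewrite Y !ev_cons ev_nil t1E /t /moebius; field.
by rewrite qx qp lt0r_neq0.
Qed.

Lemma zpositive_between (p q d : Z) a x :
    (0 < d)%BZ -> zpositive (zhom [:: p; q] [:: d; d] a) ->
  ZR p < ZR d * x < ZR q -> 0 < ev a x.
Proof.
move=> d0 pos pxq; have [c c0 E] := ev_moebius a d0 pxq.
by rewrite -(pmulr_rgt0 _ c0) -E ev_gt0 ?moebius_gt0.
Qed.

(** The positive factors at [x] and [y] differ, so only signs are carried back, not the comparison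
    of the two values. *)
Lemma zincr_between (p q d : Z) a x y :
    (0 < d)%BZ -> zincr (zhom [:: p; q] [:: d; d] a) ->
  ZR p < ZR d * x -> x < y -> ZR d * y < ZR q -> 0 <= ev a x -> 0 < ev a y.
Proof.
move=> d0 incr px xy yq ax; have dp : 0 < ZR d by apply: ZR_gt0; lia.
have xy' : ZR d * x < ZR d * y by rewrite ltr_pM2l.
have bx : ZR p < ZR d * x < ZR q by rewrite px (lt_trans xy').
have by_ : ZR p < ZR d * y < ZR q by rewrite yq (lt_trans px).
have [c c0 Ex] := ev_moebius a d0 bx.
have [e e0 Ey] := ev_moebius a d0 by_.
have mx0 : 0 <= ev (zhom [:: p; q] [:: d; d] a) (moebius p q d x).
  by rewrite Ex mulr_ge0 // ltW.
rewrite -(pmulr_rgt0 _ e0) -Ey; apply: le_lt_trans mx0 _.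
apply: zincr_homo => //; first exact: moebius_gt0.
  exact: moebius_incr.
by rewrite Ex mulr_ge0 // ltW.
Qed.

(** Homogenising with the constants [p] and [d] reduces the sign at a rational point to that of one
    integer, the head of the list. *)
Lemma ev_rat (p d : Z) a : (0 < d)%BZ -> exists2 c : R,
  0 < c & ev (zhom [:: p] [:: d] a) 0 = c * ev a (ZR p / ZR d).
Proof.
move=> d0; have dp : 0 < ZR d by apply: ZR_gt0; lia.
have Z1 (z : Z) : ev [:: z] (0 : R) = ZR z by rewrite ev_cons mul0r addr0.
exists (ZR d ^+ size a / ZR d); first by rewrite divr_gt0 ?exprn_gt0.
have := @ev_hom [:: p] [:: d] a 0; rewrite !Z1 => /(_ (lt0r_neq0 dp)) E.
by apply: (mulIf (lt0r_neq0 dp)); rewrite E mulrAC divfK // lt0r_neq0.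
Qed.

Lemma ev_at0 a : ev a 0 = ZR (head 0%BZ a).
Proof. by case: a => [|c a]; rewrite ?ev_nil // ev_cons mul0r addr0. Qed.

Lemma ev_rat_gt0 (p d : Z) a : (0 < d)%BZ ->
  Z.ltb 0 (head 0%BZ (zhom [:: p] [:: d] a)) -> 0 < ev a (ZR p / ZR d).
Proof.
move=> /(ev_rat p a)[c c0 E] h.
by rewrite -(pmulr_rgt0 _ c0) -E ev_at0 ZR_gt0.
Qed.

Lemma ev_rat_lt0 (p d : Z) a : (0 < d)%BZ ->
  Z.ltb (head 0%BZ (zhom [:: p] [:: d] a)) 0 -> ev a (ZR p / ZR d) < 0.
Proof.
move=> /(ev_rat p a)[c c0 E] h.
by rewrite -(pmulr_rlt0 _ c0) -E ev_at0 ZR_lt0.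
Qed.

End Evaluation.

(** * Independence polynomials *)

Fixpoint upper_rows (T : Type) (e : rel T) (s : seq T) : seq bitseq :=
  if s is x :: s' then map (e x) s' :: upper_rows e s' else [::].

Definition bits_or (a b : bitseq) : bitseq := [seq p.1 || p.2 | p <- zip a b].

(* [rows] is the strict upper triangle of the adjacency matrix, and [forbidden]
   marks the vertices adjacent to those already chosen. *)
Fixpoint indep_poly (rows : seq bitseq) (forbidden : bitseq) : seq Z :=
  match rows, forbidden with
  | row :: rows', b :: forbidden' =>
    if b then indep_poly rows' forbidden' else
    zadd (indep_poly rows' forbidden')
         (0%BZ :: indep_poly rows' (bits_or row forbidden'))
  | _, _ => [:: 1%BZ]
  end.

Definition graph_poly (T : Type) (e : rel T) (s : seq T) : seq Z :=
  indep_poly (upper_rows e s) (nseq (size s) false).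

Lemma upper_rows_map (T U : Type) (f : U -> T) (e : rel T) (s : seq U) :
  upper_rows e (map f s) = upper_rows (relpre f e) s.
Proof. by elim: s => //= x s <-; rewrite -map_comp. Qed.

Lemma eq_in_upper_rows (T : eqType) (e e' : rel T) (s : seq T) :
  {in s &, e =2 e'} -> upper_rows e s = upper_rows e' s.
Proof.
elim: s => //= x s IH ee'; rewrite IH; last first.
  by move=> y z ys zs; apply: ee'; rewrite inE ?ys ?zs orbT.
congr (_ :: _); apply/eq_in_map => y ys.
by rewrite ee' ?mem_head // inE ys orbT.
Qed.

Lemma nth_zadd a b k : nth 0%BZ (zadd a b) k = (nth 0 a k + nth 0 b k)%BZ.
Proof.
by elim: a b k => [|x a IH] [|y b] [|k] //=; rewrite ?IH ?Z.add_0_r ?nth_nil.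
Qed.

(** * Counting independent sets by vertex deletion *)

Section IndependentSets.
Variable G : sgraph.
Implicit Types (A S : {set G}) (x : G) (s : seq G).

Definition indep_in A k : {set {set G}} :=
  [set S : {set G} | [&& independent S, S \subset A & #|S| == k]].

Lemma independentP S :
  reflect {in S &, forall u v, ~~ adj u v} (independent S).
Proof.
apply: (iffP forall_inP) => [ind u v uS vS|ind u uS].
  by have /forall_inP := ind u uS; apply.
by apply/forall_inP => v vS; apply: ind.
Qed.

Lemma independentU1 x S :
  independent (x |: S) = independent S && [disjoint S & adj x].
Proof.
rewrite disjoint_subset.
apply/independentP/andP => [ind|[/independentP ind /subsetP xS] u v].
  split; first by apply/independentP => u v uS vS; apply: ind; rewrite inE ?uS ?vS orbT.
  by apply/subsetP => y yS; rewrite inE; apply: ind; rewrite !inE ?eqxx ?yS ?orbT.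
rewrite !inE => /orP[/eqP->|uS] /orP[/eqP->|vS]; rewrite ?adj_irr //.
- exact: xS.
- by rewrite adj_sym; apply: xS.
- exact: ind.
Qed.

Lemma card_indep_in0 A : #|indep_in A 0| = 1%N.
Proof.
rewrite -(cards1 (set0 : {set G})); apply: eq_card => S; rewrite !inE cards_eq0.
apply/and3P/idP => [[]//|/eqP->]; split; rewrite ?sub0set //.
by apply/independentP => u v; rewrite inE.
Qed.

(** Sets avoiding [x] lie in [A :\ x]; removing [x] from the others leaves independent sets of size
    [k] among its non-neighbours. *)
Lemma card_indep_inS A x k : x \in A ->
  #|indep_in A k.+1| = (#|indep_in (A :\ x) k.+1|
                        + #|indep_in [set y in A :\ x | ~~ adj x y] k|)%N.
Proof.
move=> xA; rewrite -(cardsID [set S : {set G} | x \notin S]); congr (_ + _)%N.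
  apply: eq_card => S; rewrite !inE subsetD1.
  by case: (x \notin S); rewrite ?andbT ?andbF.
rewrite -[RHS](card_in_imset (f := fun S => x |: S)); last first.
  move=> S S'; rewrite !inE => /and3P[_ /subsetP sS _] /and3P[_ /subsetP sS' _].
  have xS : x \notin S by apply/negP => /sS; rewrite !inE eqxx.
  have xS' : x \notin S' by apply/negP => /sS'; rewrite !inE eqxx.
  by move/(congr1 (fun U => U :\ x)); rewrite !setU1K.
apply: eq_card => S; apply/idP/imsetP.
  rewrite !inE negbK => /andP[xS /and3P[]]; rewrite -{1}(setD1K xS) independentU1.
  case/andP=> ind dis SA; rewrite (cardsD1 x) xS eqSS => cS.
  exists (S :\ x); last by rewrite setD1K.
  rewrite inE ind cS andbT /=; apply/subsetP => y yS; rewrite !inE.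
  move: dis; rewrite disjoint_subset => /subsetP/(_ y yS).
  by move: yS; rewrite 2!inE => /andP[-> /(subsetP SA)->].
case=> S'; rewrite !inE => /and3P[ind /subsetP SA cS] ->.
have xS' : x \notin S' by apply/negP => /SA; rewrite !inE eqxx.
rewrite !inE eqxx /= independentU1 ind cardsU1 xS' add1n eqSS cS !andbT /=.
apply/andP; split.
  by rewrite disjoint_subset; apply/subsetP => y /SA; rewrite !inE => /andP[_].
rewrite subUset sub1set xA; apply/subsetP => y /SA; rewrite !inE.
by case/andP=> /andP[].
Qed.

(** Stated for any [F], because choosing the head vertex adds its neighbourhood to the forbidden
    set; the recursion is that of [card_indep_inS]. *)
Lemma nth_indep_poly s (F : pred G) k : uniq s ->
  nth 0%BZ (indep_poly (upper_rows adj s) (map F s)) k =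
  Z.of_nat #|indep_in [set y in s | ~~ F y] k|.
Proof.
elim: s F k => [|x s IH] F k.
  move=> _; rewrite (_ : [set y in [::] | _] = set0); last by apply/setP => y; rewrite !inE.
  case: k => [|k] /=; first by rewrite card_indep_in0.
  rewrite nth_nil (_ : indep_in _ _ = set0) ?cards0 //.
  apply/setP => S; rewrite !inE subset0; apply/and3P => -[_ /eqP->].
  by rewrite cards0.
rewrite [uniq _]/= => /andP[xs us] /=; case: ifP => Fx.
  rewrite IH //; congr (Z.of_nat #|indep_in _ _|); apply/setP => y; rewrite !inE.
  by case: eqP => // ->; rewrite Fx (negbTE xs).
have -> : bits_or (map (adj x) s) (map F s) = map (fun y => adj x y || F y) s.
  by rewrite /bits_or; elim: (s) => //= y s' ->.
have xA : x \in [set y in x :: s | ~~ F y] by rewrite !inE eqxx Fx.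
have Ax : [set y in x :: s | ~~ F y] :\ x = [set y in s | ~~ F y].
  apply/setP => y; rewrite !inE; case: eqP => //= ->.
  by rewrite (negbTE xs).
rewrite nth_zadd IH //; case: k => [|k] /=; first by rewrite !card_indep_in0.
rewrite IH // (card_indep_inS _ xA) Ax Nat2Z.inj_add; congr (_ + Z.of_nat #|indep_in _ _|)%BZ.
by apply/setP => y; rewrite !inE negb_or andbA andbAC.
Qed.

Lemma nth_graph_poly s k : uniq s -> s =i G ->
  nth 0%BZ (graph_poly adj s) k = Z.of_nat (indep_num G k).
Proof.
move=> us sG; rewrite /graph_poly.
have -> : nseq (size s) false = map pred0 s by elim: (s) => //= y s' ->.
rewrite nth_indep_poly //; congr (Z.of_nat _); apply: eq_card => S; rewrite !inE.
by case: independent => //=; rewrite (_ : _ \subset _) //; apply/subsetP => y _; rewrite !inE sG.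
Qed.

Lemma occupancyE (R : realType) s (x : R) : uniq s -> s =i G ->
  occupancy G x = x * ev (zderiv (graph_poly adj s)) x
                  / ((size s)%:R * ev (graph_poly adj s) x).
Proof.
move=> us sG.
have -> : size s = #|G| by rewrite -(card_uniqP us); apply: eq_card.
rewrite /occupancy; suff -> : partition_function G R = zpoly R (graph_poly adj s).
  by rewrite ev_deriv.
apply/polyP => k; rewrite coef_poly coef_zpoly nth_graph_poly // -ZR_nat.
(* The partition function stops at degree [#|G|]; no independent set is larger. *)
case: ltnP => // nk; rewrite (_ : indep_num G k = 0%N) //; apply/eqP.
rewrite cards_eq0 -subset0; apply/subsetP => S; rewrite !inE.
case/andP=> _ /eqP cS; move: nk; rewrite -cS ltnNge.
by rewrite max_card.
Qed.

End IndependentSets.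

(** * Graphs of girth 5 *)

(** Indicator sequences of the [k]-element subsets of the positions marked in [mask]. *)
Fixpoint choices (mask : bitseq) (k : nat) : seq bitseq :=
  if mask is b :: mask' then
    [seq false :: c | c <- choices mask' k] ++
    (if k is k'.+1 then if b then [seq true :: c | c <- choices mask' k']
                        else [::] else [::])
  else if k is 0%N then [:: [::]] else [::].

Definition common (r r' : bitseq) : nat := count (fun p => p.1 && p.2) (zip r r').

Section Search.
Variables (n d : nat) (valid final : seq bitseq -> bool).

(* The rows already filled in determine the first [v] bits of row [v] by symmetry;
   [allowed] discards later neighbours closing a triangle or a 4-cycle. *)
Definition extensions (rows : seq bitseq) : seq bitseq :=
  let v := size rows in
  let back := [seq nth false r v | r <- rows] in
  let allowed j :=
    ~~ has (fun r => if nth false r j then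
                       nth false r v || (0 < common r back)%N else false) rows in
  let k := count id back in
  if (k <= d)%N then
    [seq row <- [seq back ++ false :: c | c <- choices (map allowed (iota v.+1 (n - v.+1))) (d - k)]
       | all (fun r => (common r row <= ~~ nth false r v)%N) rows]
  else [::].

(** A branch rejected by [valid] counts as a success, so [search_sound] asks that the actual matrix
    pass [valid] at every stage. *)
Fixpoint search (fuel : nat) (rows : seq bitseq) : bool :=
  if fuel is m.+1 then
    all (fun row => let rows' := rcons rows row in
                    if valid rows' then search m rows' else true)
        (extensions rows)
  else final rows.

Variable A : rel nat.
Hypothesis A_sym : symmetric A.
Hypothesis A_irr : irreflexive A.
Hypothesis A_reg : forall v, (v < n)%N -> count (A v) (iota 0 n) = d.
(* Neither triangles nor 4-cycles. *)
Hypothesis A_codeg : forall u v, (u < n)%N -> (v < n)%N -> u != v ->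
  (count (fun j => A u j && A v j) (iota 0 n) <= ~~ A u v)%N.

Definition adj_rows k : seq bitseq := [seq map (A v) (iota 0 n) | v <- iota 0 k].

Lemma mem_choices mask c : size c = size mask ->
  (forall i, nth false c i -> nth false mask i) -> c \in choices mask (count id c).
Proof.
elim: mask c => [|b mask IH] [|x c] //= [sc] sub.
have {}IH : c \in choices mask (count id c) by apply: IH => // i; apply: (sub i.+1).
rewrite mem_cat; case: x sub => sub; last by rewrite add0n map_f.
have b1 : b by exact: (sub 0%N isT).
by rewrite add1n b1 map_f ?orbT.
Qed.

Lemma nth_row u j : (j < n)%N -> nth false (map (A u) (iota 0 n)) j = A u j.
Proof. by move=> jn; rewrite (nth_map 0%N) ?size_iota // nth_iota. Qed.

(** The actual row survives every filter: symmetry gives its first part, regularity its remaining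
    degree, and the codegree bound rules out the discarded neighbours. *)
Lemma mem_extensions v : (v < n)%N ->
  map (A v) (iota 0 n) \in extensions (adj_rows v).
Proof.
move=> vn; rewrite /extensions size_map size_iota.
set back := [seq nth false r v | r <- adj_rows v].
have backE : back = map (A v) (iota 0 v).
  rewrite /back /adj_rows -map_comp; apply/eq_in_map => u; rewrite mem_iota /= => uv.
  by rewrite nth_row // A_sym.
have nE : n = (v + (n - v.+1).+1)%N by lia.
have rowE : map (A v) (iota 0 n) = back ++ false :: map (A v) (iota v.+1 (n - v.+1)).
  by rewrite {1}nE iotaD map_cat /= A_irr backE.
have deg : (count id back + count (A v) (iota v.+1 (n - v.+1)) = d)%N.
  rewrite -(A_reg vn) {2}nE iotaD count_cat /= A_irr backE count_map.
  by rewrite add0n add0n.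
rewrite -{1}deg leq_addr mem_filter; apply/andP; split.
  apply/allP => _ /mapP[u + ->]; rewrite mem_iota /= add0n => uv.
  have un := ltn_trans uv vn.
  rewrite nth_row // /common zip_map count_map.
  by apply: A_codeg => //; rewrite ltn_eqF.
rewrite rowE; apply: (map_f (fun c => back ++ false :: c)).
have -> : (d - count id back = count id (map (A v) (iota v.+1 (n - v.+1))))%N.
  by rewrite -deg addKn count_map.
apply: mem_choices; rewrite ?size_map ?size_iota // => i.
case: (ltnP i (n - v.+1)) => [ilt|ige]; last by rewrite nth_default ?size_map ?size_iota.
rewrite !(nth_map 0%N) ?size_iota // nth_iota //.
set j := (v.+1 + i)%N => vj; have jn : (j < n)%N by rewrite /j; lia.
have vltj : (v < j)%N by rewrite /j; lia.
apply/hasPn => _ /mapP[u + ->]; rewrite mem_iota /= add0n => uv.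
have un := ltn_trans uv vn.
rewrite !nth_row //; case: ifP => // uj; rewrite negb_or.
have := A_codeg un vn; rewrite ltn_eqF // => /(_ isT).
have jin : j \in iota 0 n by rewrite mem_iota.
case: (boolP (A u v)) => [uv'|_] /=.
  rewrite leqn0 -[_ == _]negbK -lt0n -has_count => /hasPn/(_ j jin).
  by rewrite uj vj.
(* A common neighbour of [u] and [v] before [v] would, together with [j] after it, make two. *)
rewrite leqNgt; apply: contra; rewrite /common backE.
have -> : map (A u) (iota 0 n) = map (A u) (iota 0 v ++ iota v (n - v)).
  by rewrite -iotaD subnKC // ltnW.
rewrite map_cat -(cats0 (map (A v) _)) zip_cat ?size_map // count_cat.
rewrite zip_map count_map [X in (_ + X)%N](_ : _ = 0)%N ?addn0; last first.
  by case: (map _ _).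
move=> c1; have -> : iota 0 n = iota 0 v ++ iota v (n - v) by rewrite -iotaD subnKC // ltnW.
rewrite count_cat -addn1 leq_add // -has_count.
by apply/hasP; exists j; rewrite ?uj ?vj // mem_iota; lia.
Qed.

Lemma search_sound k : (k <= n)%N -> search (n - k) (adj_rows k) ->
  (forall v, valid (adj_rows v)) -> final (adj_rows n).
Proof.
move=> kn + val; have [m] : exists m, m = (n - k)%N by exists (n - k)%N.
move=> mE; rewrite -mE; elim: m k kn mE => [|m IH] k kn mE /=.
  by have -> : n = k by lia.
move/allP/(_ _ (mem_extensions (_ : (k < n)%N))) => H.
have kn' : (k < n)%N by lia.
have rowsE : rcons (adj_rows k) (map (A k) (iota 0 n)) = adj_rows k.+1.
  by rewrite /adj_rows -[in RHS]addn1 iotaD map_cat cats1 add0n.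
by move: (H kn'); rewrite rowsE val; apply: IH; lia.
Qed.

End Search.

(** Lexicographic order on the adjacencies to [w], then to [z], adjacent vertices first. *)
Definition lex (T : Type) (e : rel T) (w z : T) : rel T := fun x y =>
  (e w y ==> e w x) && ((e w x == e w y) ==> (e z y ==> e z x)).

Definition bit_rel (rows : seq bitseq) : rel nat :=
  fun i j => nth false (nth [::] rows i) j.

(** Each listed [c] is such that [c] and [c.+1] are children of the same neighbour of the root. *)
Definition sorted_children (rows : seq bitseq) : bool :=
  all (fun c => lex (bit_rel rows) 5 6 c c.+1) [:: 7; 8; 10; 11; 13; 14; 16; 17]%N.

Definition poly_rob : seq Z := [:: 1; 19; 133; 437; 703; 516; 137; 4]%BZ.

Definition has_poly_rob (rows : seq bitseq) : bool :=
  graph_poly (bit_rel rows) (iota 0 19) == poly_rob.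

(* Vertex 0 is the root, 1 to 4 are its neighbours, 5 and 6 are the two vertices
   at distance 3, and 7 to 18 are the children of 1 to 4, in this order. *)
Definition first_rows : seq bitseq :=
  [seq [seq j \in l | j <- iota 0 19] | l <-
    [:: [:: 1; 2; 3; 4]; [:: 0; 7; 8; 9]; [:: 0; 10; 11; 12];
        [:: 0; 13; 14; 15]; [:: 0; 16; 17; 18]]%N].

Lemma search_rob : search 19 4 sorted_children has_poly_rob (19 - 5) first_rows.
Proof. by vm_compute. Qed.

Lemma bit_rel_adj_rows n A v i j : (j < n)%N ->
  bit_rel (adj_rows n A v) i j = (i < v)%N && A i j.
Proof.
move=> jn; rewrite /bit_rel /adj_rows; case: ltnP => [iv|vi].
  by rewrite (nth_map 0%N) ?size_iota // nth_iota // nth_row.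
by rewrite [nth [::] _ _]nth_default ?size_map ?size_iota // nth_nil.
Qed.

(** Rows not yet filled in read as false, which makes their conditions vacuous; partial matrices can
    thus be tested, and pruning starts as soon as row 5 is known. *)
Lemma lex_adj_rows n (A : rel nat) v c c' : (c < n)%N -> (c' < n)%N ->
  lex A 5 6 c c' -> lex (bit_rel (adj_rows n A v)) 5 6 c c'.
Proof.
move=> cn cn'; rewrite /lex !bit_rel_adj_rows //.
case: (ltnP 6 v) => [v6|v6]; first by rewrite (ltnW v6).
by rewrite implybT andbT; case: ltnP => // _ /andP[].
Qed.

Lemma lex_total (T : Type) (e : rel T) w z : total (lex e w z).
Proof.
move=> x y; rewrite /lex.
by case: (e w x); case: (e w y); case: (e z x); case: (e z y).
Qed.

(** * Labelling a 4-regular graph of girth 5 on 19 vertices *)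

Section Robertson.
Variables (G : sgraph) (hG : is_Robertson G).

Definition neighbours (v : G) : {set G} := [set u | adj v u].

Lemma card_neighbours v : #|neighbours v| = 4%N.
Proof. by have [_ reg _] := hG; apply: reg. Qed.

Lemma adj_neq (u v : G) : adj u v -> u != v.
Proof. by apply: contraTneq => ->; rewrite adj_irr. Qed.

Lemma no_triangle (a b c : G) : adj a b -> adj b c -> ~~ adj a c.
Proof.
move=> ab bc; apply/negP => ac; case: hG => _ _ [_ _ /(_ 3%N isT)]; apply.
exists [:: a; b; c] => //; rewrite /ucycle /= ab bc adj_sym ac !inE negb_or.
by rewrite !adj_neq.
Qed.

Lemma no_4cycle (a b c d : G) :
  a != c -> adj a b -> adj b c -> adj a d -> adj d c -> b = d.
Proof.
move=> ac ab bc ad dc; apply/eqP/negP => /negP bd.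
case: hG => _ _ [_ _ /(_ 4%N isT)]; apply.
have cd : adj c d by rewrite adj_sym.
have da : adj d a by rewrite adj_sym.
exists [:: a; b; c; d] => //; rewrite /ucycle /= ab bc cd da !inE !negb_or ac bd.
by rewrite !adj_neq.
Qed.

Lemma codegree (u v : G) : u != v ->
  (#|[set x | adj u x && adj v x]| <= ~~ adj u v)%N.
Proof.
move=> uv; case: (boolP (adj u v)) => auv /=.
  rewrite leqn0 cards_eq0 -subset0; apply/subsetP => x; rewrite !inE.
  by case/andP=> ux vx; rewrite (negbTE (no_triangle auv vx)) in ux.
apply/card_le1_eqP => x y; rewrite !inE ![adj v _]adj_sym.
by move=> /andP[ux xv] /andP[uy yv]; apply: no_4cycle uv uy yv ux xv.
Qed.

Lemma bfs_labelling (r : G) : exists bs w z (kids : G -> seq G),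
  [/\ size bs = 4%N, forall x, adj r x = (x \in bs),
      {in bs, forall b, [/\ size (kids b) = 3%N,
         forall x, adj b x = (x \in r :: kids b) & sorted (lex adj w z) (kids b)]}
    & uniq (r :: bs ++ [:: w; z] ++ flatten (map kids bs))].
Proof.
pose bs := enum (neighbours r).
have bsE x : (x \in bs) = adj r x by rewrite mem_enum inE.
pose kids0 (b : G) := enum (neighbours b :\ r).
have kids0E b x : (x \in kids0 b) = (x != r) && adj b x by rewrite mem_enum !inE.
have size_kids0 b : b \in bs -> size (kids0 b) = 3%N.
  rewrite bsE adj_sym => br; rewrite -cardE.
  have := card_neighbours b; rewrite (cardsD1 r) inE br.
  by case.
have uniq_kids : uniq (flatten (map kids0 bs)).
  rewrite -[map _ _](eq_map (fun b => map_id (kids0 b))).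
  apply: allpairs_uniq_dep; first exact: enum_uniq.
    by move=> b _; apply: enum_uniq.
  move=> p p' /allpairsPdep[b [x [bb xb ->]]] /allpairsPdep[b' [x' [bb' xb' ->]]].
  move=> /= xx'; rewrite -{}xx' in xb' *; rewrite !bsE !kids0E in bb bb' xb xb'.
  case/andP: xb => xr bx; case/andP: xb' => _ bx'.
  by rewrite (@no_4cycle r b x b') // eq_sym.
have in_kids x : x \in flatten (map kids0 bs) -> x \notin r :: bs.
  case/flattenP => _ /mapP[b bb ->]; rewrite kids0E inE negb_or bsE.
  case/andP=> -> bx; rewrite bsE in bb.
  exact: no_triangle bb bx.
pose ball := (r :: bs) ++ flatten (map kids0 bs).
have uniq_ball : uniq ball.
  rewrite cat_uniq uniq_kids /= enum_uniq bsE adj_irr /= andbT.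
  by apply/hasPn.
have size_bs : size bs = 4%N by rewrite -cardE card_neighbours.
have size_ball : size ball = 17%N.
  rewrite size_cat /= size_bs size_flatten /shape -map_comp.
  have /eq_in_map -> : {in bs, size \o kids0 =1 fun=> 3%N} by move=> b /size_kids0.
  by case: (bs) size_bs => [|? [|? [|? [|? []]]]].
have card_far : size (enum [predC ball]) = 2%N.
  rewrite -cardE; apply/eqP; rewrite -(eqn_add2l #|ball|) cardC.
  by rewrite (card_uniqP uniq_ball) size_ball; case: hG => ->.
case farE: (enum _) card_far => [|w [|z []]] // _.
(* Sorting has to wait for [w] and [z]; it permutes each block of children, so distinctness
   persists. *)
pose kids b := sort (lex adj w z) (kids0 b).
exists bs, w, z, kids; split=> // [b bb|].
  split; first by rewrite size_sort size_kids0.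
    move=> x; rewrite inE mem_sort kids0E; case: eqP => //= ->.
    by rewrite adj_sym -bsE.
  exact/sort_sorted/lex_total.
have kidsE : flatten (map kids bs) =i flatten (map kids0 bs).
  move=> x; apply/flatten_mapP/flatten_mapP => -[b bb xb]; exists b => //.
    by rewrite -(mem_sort (lex adj w z)).
  by rewrite mem_sort.
have size_kids : size (flatten (map kids bs)) = size (flatten (map kids0 bs)).
  rewrite !size_flatten /shape -!map_comp; congr sumn; apply: eq_map => b /=.
  exact: size_sort.
have uniq_far : uniq (ball ++ [:: w; z]).
  rewrite cat_uniq uniq_ball -farE enum_uniq andbT /=.
  by apply/hasPn => x; rewrite mem_enum.
have -> // : uniq (r :: bs ++ [:: w; z] ++ flatten (map kids bs)) = uniq (ball ++ [:: w; z]).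
apply: eq_uniq; first by rewrite -cat_cons /ball !size_cat size_kids [(size [:: w; z] + _)%N]addnC addnA.
move=> x; rewrite /ball !(inE, mem_cat) kidsE.
by case: (x == r); case: (x \in bs); case: (x == w); case: (x == z); rewrite //= ?orbT ?orbF.
Qed.

Lemma row_neighbours (s : seq G) x0 v (l : seq nat) : uniq s ->
    (forall x, adj v x = (x \in map (nth x0 s) l)) ->
    all (fun i => i < size s)%N l ->
  [seq adj v (nth x0 s j) | j <- iota 0 (size s)] =
  [seq j \in l | j <- iota 0 (size s)].
Proof.
move=> us adjE /allP ls; apply/eq_in_map => j; rewrite mem_iota /= add0n => js.
rewrite adjE; apply/mapP/idP => [[i il /eqP]|jl]; last by exists j.
by rewrite nth_uniq ?js ?(ls i il) // => /eqP->.
Qed.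

(** Under the labelling [s], the adjacency matrix extends [first_rows] and respects the sorting, so
    it is a leaf reached by the search. *)
Lemma graph_poly_labelling (s : seq G) x0 (A : rel nat := relpre (nth x0 s) adj) :
    uniq s -> s =i G -> adj_rows 19 A 5 = first_rows ->
    all (fun c => lex A 5 6 c c.+1) [:: 7; 8; 10; 11; 13; 14; 16; 17]%N ->
  graph_poly adj s = poly_rob.
Proof.
move=> us sG rows5 /allP lexA.
have size_s : size s = 19%N.
  by rewrite -(card_uniqP us) (eq_card sG); case: hG.
have count_s (p : pred G) :
    count (fun j => p (nth x0 s j)) (iota 0 19) = #|[set x | p x]|.
  rewrite -(count_map (nth x0 s) p) -size_s map_nth_iota0 // take_size.
  rewrite -size_filter cardE; apply/perm_size/uniq_perm.
  - exact: filter_uniq.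
  - exact: enum_uniq.
  - by move=> x; rewrite mem_filter sG mem_enum !inE andbT.
have : has_poly_rob (adj_rows 19 A 19).
  apply: (@search_sound 19 4 sorted_children has_poly_rob A _ _ _ _ 5).
  - by move=> i j; rewrite /A /= adj_sym.
  - by move=> i; rewrite /A /= adj_irr.
  - by move=> v _; rewrite (count_s (adj (nth x0 s v))) card_neighbours.
  - move=> u v u19 v19 uv.
    rewrite (count_s (fun x => adj (nth x0 s u) x && adj (nth x0 s v) x)).
    by apply: codegree; rewrite nth_uniq ?size_s.
  - by [].
  - by rewrite rows5; apply: search_rob.
  - move=> v; apply/allP => c cin; apply: lex_adj_rows; last exact: lexA.
      by move: c cin {lexA}; apply/allP.
    by move: c cin {lexA}; apply/allP.
rewrite /has_poly_rob /graph_poly size_iota size_s => /eqP <-.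
rewrite -[s in upper_rows _ s]take_size -(map_nth_iota0 x0) // size_s.
rewrite upper_rows_map.
have /eq_in_upper_rows -> // : {in iota 0 19 &, A =2 bit_rel (adj_rows 19 A 19)}.
by move=> i j; rewrite !mem_iota => /= i19 j19; rewrite bit_rel_adj_rows ?i19.
Qed.

Lemma graph_poly_rob :
  exists s : seq G, [/\ uniq s, s =i G, size s = 19%N & graph_poly adj s = poly_rob].
Proof.
have cardG : #|G| = 19%N by case: hG.
have [r _] : exists r : G, r \in G by apply/card_gt0P; rewrite cardG.
have [bs [w [z [kids [size_bs bsE kidsE us]]]]] := bfs_labelling r.
case: bs size_bs bsE kidsE us => [|b1 [|b2 [|b3 [|b4 []]]]] // _ rE kidsE.
have [] := kidsE b1; first by rewrite !inE eqxx ?orbT.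
have [] := kidsE b2; first by rewrite !inE eqxx ?orbT.
have [] := kidsE b3; first by rewrite !inE eqxx ?orbT.
have [] := kidsE b4; first by rewrite !inE eqxx ?orbT.
rewrite [map _ _]/= [flatten _]/=.
case: (kids b4) => [|x10 [|x11 [|x12 []]]] // _ b4E /and3P[l7 l8 _].
case: (kids b3) => [|x7 [|x8 [|x9 []]]] // _ b3E /and3P[l5 l6 _].
case: (kids b2) => [|x4 [|x5 [|x6 []]]] // _ b2E /and3P[l3 l4 _].
case: (kids b1) => [|x1 [|x2 [|x3 []]]] // _ b1E /and3P[l1 l2 _].
(* The order must match the numbering used in [first_rows] and [sorted_children]. *)
pose s := [:: r; b1; b2; b3; b4; w; z; x1; x2; x3; x4; x5; x6; x7; x8; x9; x10; x11; x12].
move=> us; have {}us : uniq s := us.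
have sG : s =i G.
  apply/subset_cardP; last by apply/subsetP.
  by rewrite cardG (card_uniqP us).
exists s; split => //; apply: (@graph_poly_labelling s r) => //; last first.
  do ![apply/andP; split=> //].
have row v l H1 H2 := @row_neighbours s r v l us H1 H2.
rewrite /adj_rows [map _ (iota 0 5)]/= /first_rows [map _ [:: _; _; _; _; _]]/=.
congr [:: _; _; _; _; _].
- exact: (row r [:: 1; 2; 3; 4]%N).
- exact: (row b1 [:: 0; 7; 8; 9]%N).
- exact: (row b2 [:: 0; 10; 11; 12]%N).
- exact: (row b3 [:: 0; 13; 14; 15]%N).
- exact: (row b4 [:: 0; 16; 17; 18]%N).
Qed.

End Robertson.

(** * Comparison of occupancy fractions *)

Definition poly_cyc13 : seq Z := [:: 1; 13; 52; 78; 39]%BZ.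
Definition poly20 : seq Z := [:: 1; 20; 150; 540; 988; 888; 328; 16]%BZ.
Definition poly22 : seq Z :=
  [:: 1; 22; 187; 792; 1793; 2145; 1232; 264; 11]%BZ.

(** An explicit list on which [vm_compute] evaluates; it also serves ['Z_13] and ['Z_22], which are
    ordinal types. *)
Definition ord_list n : seq 'I_n.+1 := map inZp (iota 0 n.+1).

Lemma mem_ord_list n : ord_list n =i 'I_n.+1.
Proof.
move=> i; rewrite -[i]valZpK map_f // mem_iota; exact: ltn_ord.
Qed.

Lemma graph_poly_cyc13 : graph_poly (@adj CYC13) (ord_list 12) = poly_cyc13.
Proof. by vm_compute. Qed.

Lemma graph_poly20 : graph_poly (@adj G20) (ord_list 19) = poly20.
Proof. by vm_compute. Qed.

Lemma graph_poly22 : graph_poly (@adj G22) (ord_list 21) = poly22.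
Proof. by vm_compute. Qed.

Definition lambda4_coefs : seq Z :=
  [:: -65; -679; -2265; -593; 11895; 23576; 11321; -7612; -7040; -724; 8]%BZ.
(* The sign is reversed, so that the leading coefficient is positive. *)
Definition lambda5_coefs : seq Z :=
  [:: -6; -137; -1356; -7266; -22158; -36870; -25646; 9658; 25296; 11612;
      952; 24]%BZ.
Definition lambda6_coefs : seq Z :=
  [:: -17; -181; -747; -1477; -1340; -318; 252; 132]%BZ.

Section Real.
Variable R : realType.
Implicit Types x y l : R.

(** Turns the numerals of the equations into [ZR] of binary integers, so that both sides of the
    [ring] identities share their coefficients. *)
Lemma natr_ZR n z : Z.of_nat n = z -> n%:R = ZR R z.
Proof. by move<-; rewrite ZR_nat. Qed.

Lemma ZR_neg p : ZR R (Zneg p) = - ZR R (Zpos p).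
Proof. exact: (ZRN R (Zpos p)). Qed.

Lemma eq_subr_iff (u v e : R) : e = u - v -> u = v <-> e = 0.
Proof. by move=> ->; split=> [->|]; [rewrite subrr | exact: subr0_eq]. Qed.

Lemma eq_oppr_iff (u e : R) : e = - u -> u = 0 <-> e = 0.
Proof. by move=> ->; split=> [->|h]; [exact: oppr0 | apply: oppr_inj; rewrite oppr0]. Qed.

Lemma lambda4_eqE x : lambda4_eq x <-> ev lambda4_coefs x = 0.
Proof.
rewrite /lambda4_eq !ev_cons ev_nil !ZR_neg.
rewrite (@natr_ZR 8 8) // (@natr_ZR 724 724) // (@natr_ZR 7040 7040) //.
rewrite (@natr_ZR 7612 7612) // (@natr_ZR 11321 11321) // (@natr_ZR 23576 23576) //.
rewrite (@natr_ZR 11895 11895) // (@natr_ZR 593 593) // (@natr_ZR 2265 2265) //.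
rewrite (@natr_ZR 679 679) // (@natr_ZR 65 65) //.
by apply: eq_subr_iff; ring.
Qed.

Lemma lambda5_eqE x : lambda5_eq x <-> ev lambda5_coefs x = 0.
Proof.
rewrite /lambda5_eq !ev_cons ev_nil !ZR_neg.
rewrite (@natr_ZR 24 24) // (@natr_ZR 952 952) // (@natr_ZR 11612 11612) //.
rewrite (@natr_ZR 25296 25296) // (@natr_ZR 9658 9658) // (@natr_ZR 25646 25646) //.
rewrite (@natr_ZR 36870 36870) // (@natr_ZR 22158 22158) // (@natr_ZR 7266 7266) //.
rewrite (@natr_ZR 1356 1356) // (@natr_ZR 137 137) // (@natr_ZR 6 6) //.
by apply: eq_oppr_iff; ring.
Qed.

Lemma lambda6_eqE x : lambda6_eq x <-> ev lambda6_coefs x = 0.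
Proof.
rewrite /lambda6_eq !ev_cons ev_nil !ZR_neg.
rewrite (@natr_ZR 132 132) // (@natr_ZR 252 252) // (@natr_ZR 318 318) //.
rewrite (@natr_ZR 1340 1340) // (@natr_ZR 1477 1477) // (@natr_ZR 747 747) //.
rewrite (@natr_ZR 181 181) // (@natr_ZR 17 17) //.
by apply: eq_subr_iff; ring.
Qed.

Definition zocc (n : Z) (a : seq Z) x := x * ev (zderiv a) x / (ZR R n * ev a x).

Lemma occupancy_zocc (G : sgraph) (s : seq G) n a x :
  uniq s -> s =i G -> Z.of_nat (size s) = n -> graph_poly adj s = a ->
  occupancy G x = zocc n a x.
Proof. by move=> us sG <- <-; rewrite (occupancyE _ us sG) /zocc -ZR_nat. Qed.

Lemma zocc_lt m n a b x :
    (0 < m)%BZ -> (0 < n)%BZ -> zpositive a -> zpositive b -> 0 < x ->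
  0 < ev (zcross m n a b) x -> zocc m a x < zocc n b x.
Proof.
move=> m0 n0 pa pb x0.
rewrite /zcross ev_add !ev_scale !ev_mul ZRN /zocc.
have {}pa := ev_gt0 pa x0; have {}pb := ev_gt0 pb x0.
move: (ev (zderiv a) x) (ev (zderiv b) x) => a' b' h.
have M : 0 < ZR R m by apply: ZR_gt0; lia.
have N : 0 < ZR R n by apply: ZR_gt0; lia.
rewrite -!mulrA ltr_pM2l // ltr_pdivrMr ?mulr_gt0 // mulrAC ltr_pdivlMr ?mulr_gt0 //.
rewrite -subr_gt0; suff -> : b' * (ZR R m * ev a x) - a' * (ZR R n * ev b x)
  = ZR R m * (b' * ev a x) + - ZR R n * (a' * ev b x).
  exact: h.
by ring.
Qed.

Lemma occupancy_cyc13 x : occupancy CYC13 x = zocc 13 poly_cyc13 x.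
Proof.
apply: (@occupancy_zocc CYC13 (ord_list 12) 13) graph_poly_cyc13 => //.
exact: mem_ord_list.
Qed.

Lemma occupancy20 x : occupancy G20 x = zocc 20 poly20 x.
Proof.
apply: (@occupancy_zocc G20 (ord_list 19) 20) graph_poly20 => //.
exact: mem_ord_list.
Qed.

Lemma occupancy22 x : occupancy G22 x = zocc 22 poly22 x.
Proof.
apply: (@occupancy_zocc G22 (ord_list 21) 22) graph_poly22 => //.
exact: mem_ord_list.
Qed.

Lemma occupancy_rob (G : sgraph) x : is_Robertson G ->
  occupancy G x = zocc 19 poly_rob x.
Proof.
case/graph_poly_rob=> s [us sG size_s poly_s].
by apply: occupancy_zocc us sG _ poly_s; rewrite size_s.
Qed.

Lemma ev_ivt a x y : x <= y -> ev a x < 0 -> 0 < ev a y ->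
  exists2 l, x <= l <= y & ev a l = 0.
Proof.
move=> xy ax ay; have [|l xly /rootP al] := @poly_ivt _ (zpoly R a) x y xy.
  by rewrite !ltW.
by exists l.
Qed.

(** * Functions crossing zero once, from negative to positive *)

Section SingleCrossing.
Variables (a : seq Z) (D : pred R).
Hypothesis cross : forall x y,
  0 < x -> x < y -> D y -> 0 <= ev a x -> 0 < ev a y.

Lemma crossing_neg x l : 0 < x -> x < l -> D l -> ev a l = 0 -> ev a x < 0.
Proof.
move=> x0 xl Dl al; rewrite ltNge; apply/negP => /(cross x0 xl Dl).
by rewrite al ltxx.
Qed.

Lemma crossing_pos x l : 0 < l -> l < x -> D x -> ev a l = 0 -> 0 < ev a x.
Proof. by move=> l0 lx Dx al; apply: cross l0 lx Dx _; rewrite al. Qed.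

Lemma crossing_between x y l : D x -> ev a x < 0 -> 0 < y -> 0 < ev a y ->
  0 < l -> D l -> ev a l = 0 -> x < l < y.
Proof.
move=> Dx ax y0 ay l0 Dl al; rewrite !ltNge; apply/andP; split; apply/negP.
  rewrite le_eqVlt => /predU1P[lx|lx]; first by rewrite -lx al ltxx in ax.
  by have := crossing_pos l0 lx Dx al; rewrite ltNge ltW.
rewrite le_eqVlt => /predU1P[yl|yl]; first by rewrite yl al ltxx in ay.
by have := crossing_neg y0 yl Dl al; rewrite ltNge ltW.
Qed.

Lemma crossing_unique l l' :
  0 < l -> 0 < l' -> D l -> D l' -> ev a l = 0 -> ev a l' = 0 -> l = l'.
Proof.
move=> l0 l0' Dl Dl' al al'; case: (ltgtP l l') => // ll'.
  by have := crossing_neg l0 ll' Dl' al'; rewrite al ltxx.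
by have := crossing_neg l0' ll' Dl al; rewrite al' ltxx.
Qed.

End SingleCrossing.

Lemma zincr_crossing a : zincr a -> forall x y,
  0 < x -> x < y -> predT y -> 0 <= ev a x -> 0 < ev a y.
Proof. by move=> ia x y x0 xy _ ax; apply: le_lt_trans ax (zincr_homo ia x0 xy ax). Qed.

Lemma ZR_le (u v : Z) : (u <= v)%BZ -> ZR R u <= ZR R v.
Proof. by move=> uv; rewrite /ZR ler_int; lia. Qed.

Lemma ZR_lt (u v : Z) : (u < v)%BZ -> ZR R u < ZR R v.
Proof. by move=> uv; rewrite /ZR ltr_int; lia. Qed.

(** Weakens a rational bound to one with another denominator by comparing integers; used to pass
    from the decimal brackets of the roots to bounds on [x]. *)
Lemma ratio_lt (p d p' d' : Z) x : (0 < d)%BZ -> (0 < d')%BZ ->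
  (p' * d <= d' * p)%BZ -> ZR R p / ZR R d < x -> ZR R p' < ZR R d' * x.
Proof.
move=> d0 d0' /ZR_le; have dp : 0 < ZR R d by apply: ZR_gt0; lia.
have dp' : 0 < ZR R d' by apply: ZR_gt0; lia.
rewrite !ZRM ltr_pdivrMr // => h xp; rewrite -(ltr_pM2r dp).
by apply: le_lt_trans h _; rewrite -mulrA ltr_pM2l.
Qed.

Lemma ratio_gt (p d p' d' : Z) x : (0 < d)%BZ -> (0 < d')%BZ ->
  (d' * p <= p' * d)%BZ -> x < ZR R p / ZR R d -> ZR R d' * x < ZR R p'.
Proof.
move=> d0 d0' /ZR_le; have dp : 0 < ZR R d by apply: ZR_gt0; lia.
have dp' : 0 < ZR R d' by apply: ZR_gt0; lia.
rewrite !ZRM ltr_pdivlMr // => h xp; rewrite -(ltr_pM2r dp).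
by apply: lt_le_trans h; rewrite -mulrA ltr_pM2l.
Qed.

Lemma dist_ratio n z d k l : Z.of_nat n = z -> 10 ^+ k = ZR R d ->
  ZR R (z + - 1)%BZ / ZR R d < l < ZR R (z + 1)%BZ / ZR R d ->
  `|l - n%:R / 10 ^+ k| < 1 / 10 ^+ k.
Proof.
by move=> /natr_ZR -> ->; rewrite !ZRD ZR_neg !mulrDl mulNr ltr_distl.
Qed.

Lemma pow10 k : 10 ^+ k = ZR R (Z.pow 10 (Z.of_nat k)).
Proof.
elim: k => [|k IH]; first by rewrite expr0.
by rewrite exprS IH (@natr_ZR 10 10) // -ZRM -Z.pow_succ_r ?Nat2Z.inj_succ //; lia.
Qed.

(** The coefficients in [lambda4_coefs] change sign three times, so single crossing is established
    only below 1.3, a bound that exceeds lambda5. *)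
Definition below13 : pred R := fun x => ZR R 10 * x < ZR R 13.

Lemma lambda4_crossing x y :
  0 < x -> x < y -> below13 y -> 0 <= ev lambda4_coefs x -> 0 < ev lambda4_coefs y.
Proof.
move=> x0 xy yb; apply: (@zincr_between _ 0 13 10) => //.
by rewrite mulr_gt0 // ZR_gt0.
Qed.

Lemma ratio_gt0 (p d : Z) : (0 < p)%BZ -> (0 < d)%BZ -> 0 < ZR R p / ZR R d.
Proof. by move=> p0 d0; rewrite divr_gt0 // ZR_gt0 //; lia. Qed.

Lemma ratio_le (p q d : Z) : (p <= q)%BZ -> (0 < d)%BZ ->
  ZR R p / ZR R d <= ZR R q / ZR R d.
Proof.
by move=> pq d0; rewrite ler_pM2r ?invr_gt0 ?ZR_le // ZR_gt0 //; lia.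
Qed.

(** A sign change between p/d and q/d gives existence; single crossing gives uniqueness and places
    every positive root in that bracket. *)
Lemma unique_positive_root (eqn : R -> Prop) a (p q d : Z) :
    (forall x, eqn x <-> ev a x = 0) -> zincr a ->
    (0 < d)%BZ -> (0 < p)%BZ -> (p <= q)%BZ ->
    Z.ltb (head 0%BZ (zhom [:: p] [:: d] a)) 0 ->
    Z.ltb 0 (head 0%BZ (zhom [:: q] [:: d] a)) ->
  (exists! l, positive_root eqn l) /\
  forall l, positive_root eqn l -> ZR R p / ZR R d < l < ZR R q / ZR R d.
Proof.
move=> eqnE ia d0 p0 pq /(ev_rat_lt0 R d0) ap /(ev_rat_gt0 R d0) aq.
have [l /andP[pl _] al] := ev_ivt (ratio_le pq d0) ap aq.
have l0 : 0 < l := lt_le_trans (ratio_gt0 p0 d0) pl.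
have cr := zincr_crossing ia; split.
  exists l; split=> [|l' [l0' /eqnE al']]; first by split=> //; apply/eqnE.
  exact: crossing_unique cr _ _ l0 l0' isT isT al al'.
move=> l' [l0' /eqnE al']; apply: (crossing_between cr) => //.
by apply: ratio_gt0; lia.
Qed.

(* Unfolding [ZR] on large constants produces unary numerals. *)
Opaque ZR.

(** Minimality puts any smallest root at or below the root found in the bracket, hence below 1.3,
    where the crossing is unique. *)
Lemma lambda4_smallest_root :
  (exists! l, smallest_positive_root (@lambda4_eq R) l) /\
  forall l, smallest_positive_root (@lambda4_eq R) l ->
    ZR R 434964 / ZR R 1000000 < l < ZR R 434966 / ZR R 1000000.
Proof.
have lo : ev lambda4_coefs (ZR R 434964 / ZR R 1000000) < 0 by apply: ev_rat_lt0.
have hi : 0 < ev lambda4_coefs (ZR R 434966 / ZR R 1000000) by apply: ev_rat_gt0.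
have lo0 : 0 < ZR R 434964 / ZR R 1000000 by apply: ratio_gt0.
have [|l /andP[lol lhi] al] := ev_ivt _ lo hi; first exact: ratio_le.
have l0 : 0 < l := lt_le_trans lo0 lol.
have lt13 x y : y < ZR R 434967 / ZR R 1000000 -> x <= y -> below13 x.
  by move=> yhi xy; apply: ratio_gt (le_lt_trans xy yhi).
(* One unit more in the numerator makes the weak upper bound strict. *)
have lhi' : l < ZR R 434967 / ZR R 1000000.
  apply: le_lt_trans lhi _.
  by rewrite ltr_pM2r ?invr_gt0; [apply: ZR_lt | apply: ZR_gt0].
have l13 : below13 l by apply: lt13 lhi' _.
split=> [|l' [[l0' /lambda4_eqE al'] min_l']].
  exists l; split=> [|l' [[l0' /lambda4_eqE al'] min_l']].
    split=> [|y [y0 /lambda4_eqE ay]]; first by split=> //; apply/lambda4_eqE.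
    rewrite leNgt; apply/negP => yl.
    have y13 := lt13 _ _ lhi' (ltW yl).
    by move: yl; rewrite (crossing_unique lambda4_crossing y0 l0 y13 l13 ay al) ltxx.
  have l'l : l' <= l by apply: min_l'; split=> //; apply/lambda4_eqE.
  by apply: crossing_unique lambda4_crossing _ _ l0 l0' l13 (lt13 _ _ lhi' l'l) al al'.
have l'l : l' <= l by apply: min_l'; split=> //; apply/lambda4_eqE.
have hi0 : 0 < ZR R 434966 / ZR R 1000000 by apply: ratio_gt0.
have lo13 := lt13 _ _ lhi' lol; have l'13 := lt13 _ _ lhi' l'l.
exact: (crossing_between lambda4_crossing) lo13 lo hi0 hi l0' l'13 al'.
Qed.

Lemma occupancy22_lt_rob (G : sgraph) l x : is_Robertson G ->
    0 < l -> lambda4_eq l -> l < x -> below13 x ->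
  occupancy G22 x < occupancy G x.
Proof.
move=> hG l0 /lambda4_eqE al lx x13; have x0 := lt_trans l0 lx.
rewrite occupancy22 occupancy_rob //; apply: zocc_lt => //.
(* Lists are compared literally: the final 0 of the multiplier matches the trailing zero left by
   [zderiv]. *)
have -> : zcross 22 19 poly22 poly_rob
          = zmul [:: 0; 0; 0; 0; 11; 0]%BZ lambda4_coefs by vm_compute.
rewrite ev_mul; apply: mulr_gt0; first exact: ev_gt0.
exact: crossing_pos lambda4_crossing _ _ l0 lx x13 al.
Qed.

Lemma occupancy22_lt_cyc13 x : ZR R 43 < ZR R 100 * x < ZR R 124 ->
  occupancy G22 x < occupancy CYC13 x.
Proof.
move=> xb; rewrite occupancy22 occupancy_cyc13; apply: zocc_lt => //.
  case/andP: xb => xb _.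
  by rewrite -(pmulr_rgt0 _ (_ : 0 < ZR R 100)) ?(lt_trans _ xb) ?ZR_gt0.
by apply: zpositive_between xb => //; vm_compute.
Qed.

Lemma occupancy20_lt_rob (G : sgraph) x : is_Robertson G ->
  ZR R 123 < ZR R 100 * x < ZR R 228 -> occupancy G20 x < occupancy G x.
Proof.
move=> hG xb; rewrite occupancy20 occupancy_rob //; apply: zocc_lt => //.
  case/andP: xb => xb _.
  by rewrite -(pmulr_rgt0 _ (_ : 0 < ZR R 100)) ?(lt_trans _ xb) ?ZR_gt0.
by apply: zpositive_between xb => //; vm_compute.
Qed.

Lemma occupancy20_lt_cyc13 l x : 0 < x -> x < l -> lambda6_eq l ->
  occupancy G20 x < occupancy CYC13 x.
Proof.
move=> x0 xl /lambda6_eqE al.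
rewrite occupancy20 occupancy_cyc13; apply: zocc_lt => //.
have -> : zcross 20 13 poly20 poly_cyc13
          = zscale (-1) (zmul [:: 0; 0; 0; 52; 0]%BZ lambda6_coefs) by vm_compute.
have cr := @zincr_crossing lambda6_coefs isT.
have ax : ev lambda6_coefs x < 0 := crossing_neg cr x0 xl isT al.
by rewrite ev_scale ev_mul ZR_neg mulN1r oppr_gt0 pmulr_rlt0 // ev_gt0.
Qed.

End Real.

Theorem theorem4p5 (R : realType) (GROB : sgraph) (hROB : is_Robertson GROB) :
  [/\ exists! l4 : R, smallest_positive_root (@lambda4_eq R) l4,
      exists! l5 : R, positive_root (@lambda5_eq R) l5,
      exists! l6 : R, positive_root (@lambda6_eq R) l6
    & forall l4 l5 l6 : R,
        smallest_positive_root (@lambda4_eq R) l4 ->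
        positive_root (@lambda5_eq R) l5 ->
        positive_root (@lambda6_eq R) l6 ->
        [/\ decimal_values l4 l5 l6,
            (forall x : R, l4 < x < l5 ->
               occupancy G22 x < Num.min (occupancy GROB x) (occupancy CYC13 x))
          & (forall x : R, l5 < x < l6 ->
               occupancy G20 x < Num.min (occupancy GROB x) (occupancy CYC13 x))]].
Proof.
have [l4_ex l4_bounds] := lambda4_smallest_root R.
have [l5_ex l5_bounds] : (exists! l, positive_root (@lambda5_eq R) l) /\ forall l,
    positive_root (@lambda5_eq R) l ->
    ZR R 123422 / ZR R 100000 < l < ZR R 123424 / ZR R 100000.
  by apply: (unique_positive_root (@lambda5_eqE R)).
have [l6_ex l6_bounds] : (exists! l, positive_root (@lambda6_eq R) l) /\ forall l,
    positive_root (@lambda6_eq R) l ->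
    ZR R 227937 / ZR R 100000 < l < ZR R 227939 / ZR R 100000.
  by apply: (unique_positive_root (@lambda6_eqE R)).
split=> // l4 l5 l6 l4P l5P l6P.
have b4 := l4_bounds _ l4P; have b5 := l5_bounds _ l5P; have b6 := l6_bounds _ l6P.
split.
- split.
  + by apply: (@dist_ratio R _ 434965 1000000 _ l4) b4; rewrite ?pow10.
  + by apply: (@dist_ratio R _ 123423 100000 _ l5) b5; rewrite ?pow10.
  + by apply: (@dist_ratio R _ 227938 100000 _ l6) b6; rewrite ?pow10.
- move=> x /andP[l4x xl5]; have [[l40 l4E] _] := l4P.
  (* The brackets give 0.434964 < x < 1.23424, inside both (0, 1.3) and (0.43, 1.24). *)
  have [/lt_trans/(_ l4x) lox _] := andP b4; have [_ /(lt_trans xl5) xhi] := andP b5.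
  rewrite lt_min; apply/andP; split.
    by apply: occupancy22_lt_rob l40 l4E l4x _ => //; apply: ratio_gt xhi.
  apply: occupancy22_lt_cyc13; apply/andP.
  by split; [apply: ratio_lt lox | apply: ratio_gt xhi].
- move=> x /andP[l5x xl6]; have [l50 _] := l5P; have [_ l6E] := l6P.
  (* Here 1.23422 < x < 2.27939, inside (1.23, 2.28). *)
  have [/lt_trans/(_ l5x) lox _] := andP b5; have [_ /(lt_trans xl6) xhi] := andP b6.
  rewrite lt_min; apply/andP; split.
    apply: occupancy20_lt_rob => //; apply/andP.
    by split; [apply: ratio_lt lox | apply: ratio_gt xhi].
  exact: occupancy20_lt_cyc13 (lt_trans l50 l5x) xl6 l6E.
Qed.
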